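(* Let $k$ be a field, $A$ an associative $k$-algebra, $B$ a commutative $k$-algebra and $\varepsilon:B\to A$ a morphism of $k$-algebras with $\varepsilon(B)\subset\mathcal Z(A)$. Let $M$ be an $A$-bimodule such that $\varepsilon(\alpha)m=m\varepsilon(\alpha)$ for all $\alpha\in B$, $m\in M$. Then $H^2((A,B,\varepsilon);M)$ is naturally identified with the set of equivalence classes of extensions of $B$-algebras of $A$ by $M$: assigning to an extension $0\to M\to X\stackrel{\pi}{\to}A\to0$ the class of the cocycle $c_s$ of any $k$-linear section $s$ of $\pi$ gives a well-defined bijection from the set of equivalence classes of such extensions to $H^2((A,B,\varepsilon);M)$.
   Context: All algebras are associative and unital, $\otimes=\otimes_k$, and $\mathcal Z(A)$ is the center of $A$. A $B$-algebra is a $k$-algebra $X$ with a $k$-algebra morphism $\varepsilon_X:B\to X$ whose image is central in $X$; a morphism of $B$-algebras is a $k$-algebra morphism commuting with these structure maps. $A$ is a $B$-algebra via $\varepsilon$. Low-degree secondary Hochschild cohomology. $C^1((A,B,\varepsilon);M)=\mathrm{Hom}_k(A,M)$, $C^2((A,B,\varepsilon);M)=\mathrm{Hom}_k(A\otimes A\otimes B,M)$, with $$\delta_1^\varepsilon(u)(a\otimes b\otimes\alpha)=a\varepsilon(\alpha)u(b)-u(ab\varepsilon(\alpha))+u(a)b\varepsilon(\alpha).$$ A cochain $c\in C^2$ is a $2$-cocycle (i.e. $\delta_2^\varepsilon c=0$) iff for all $a,b,d\in A$ and $\alpha,\beta,\gamma\in B$ $$a\varepsilon(\alpha\beta)c(b\otimes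 d\otimes\gamma)-c(ab\varepsilon(\alpha)\otimes d\otimes\beta\gamma)+c(a\otimes bd\varepsilon(\gamma)\otimes\alpha\beta)-c(a\otimes b\otimes\alpha)d\varepsilon(\beta\gamma)=0,$$ and $H^2((A,B,\varepsilon);M)$ is the space of $2$-cocycles modulo the image of $\delta_1^\varepsilon$. An extension of $B$-algebras of $A$ by $M$ is a $B$-algebra $X$ together with a surjective morphism of $B$-algebras $\pi:X\to A$ (so $\pi\circ\varepsilon_X=\varepsilon$) and a $k$-linear identification of $M$ with $\ker\pi$, such that $(\ker\pi)^2=0$ and the given $A$-bimodule structure of $M$ is the one induced from $X$: $am=s(a)m$, $ma=ms(a)$ for any $k$-linear section $s$ of $\pi$. Two extensions $X_1,X_2$ are equivalent if there is an isomorphism of $B$-algebras $F:X_1\to X_2$ with $\pi_2\circ F=\pi_1$ which restricts to the identity on $M$. For a $k$-linear map $s:A\to X$ with $\pi s=\mathrm{id}_A$, the cocycle $c_s:A\otimes A\otimes B\to M$ is $c_s(a\otimes b\otimes\alpha)=\varepsilon_X(\alpha)s(a)s(b)-s(\varepsilon(\alpha)ab)$. *)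

(* Defs.v *)
From HB Require Import structures.
From mathcomp Require Import all_boot all_order all_algebra.
From mathcomp Require Import boolp classical_sets functions.
From mathcomp Require Import ring_quotient.

Set Implicit Arguments.
Unset Strict Implicit.
Unset Printing Implicit Defensive.

Import GRing.Theory.
Local Open Scope ring_scope.
Local Open Scope quotient_scope.

(* Associative unital algebras over k: rings with a central ring morphism from
   k.  The type algType k of the library requires 1 != 0 and would exclude the
   zero algebra. *)
Record algebra (k : fieldType) := Algebra {
  alg_ring : pzRingType ;
  alg_scalar : {rmorphism k -> alg_ring} ;
  alg_scalarC : forall c x, alg_scalar c * x = x * alg_scalar c
}.

Definition alg_sort (k : fieldType) (X : algebra k) : Type := alg_ring X.
Coercion alg_sort : algebra >-> Sortclass.

HB.instance Definition _ k (X : algebra k) :=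
  GRing.PzRing.copy (alg_sort X) (alg_ring X).

Section AlgebraModule.
Variables (k : fieldType) (X : algebra k).

Definition alg_scale (c : k) (x : X) : X := (alg_scalar X c : X) * x.

Fact alg_scaleA c d x : alg_scale c (alg_scale d x) = alg_scale (c * d) x.
Proof. by rewrite /alg_scale rmorphM mulrA. Qed.

Fact alg_scale1 : left_id 1 alg_scale.
Proof. by move=> x; rewrite /alg_scale rmorph1 mul1r. Qed.

Fact alg_scaleDr : right_distributive alg_scale +%R.
Proof. by move=> c x y; rewrite /alg_scale mulrDr. Qed.

Fact alg_scaleDl x : {morph alg_scale^~ x : c d / c + d}.
Proof. by move=> c d; rewrite /alg_scale rmorphD mulrDl. Qed.

HB.instance Definition _ :=
  GRing.Zmodule_isLmodule.Build k (alg_sort X)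
    alg_scaleA alg_scale1 alg_scaleDr alg_scaleDl.

Lemma alg_scaleAl (c : k) (x y : X) : c *: (x * y) = (c *: x) * y.
Proof. exact: mulrA. Qed.

Lemma alg_scaleAr (c : k) (x y : X) : c *: (x * y) = x * (c *: y).
Proof.
have cx : alg_scalar X c * x = x * alg_scalar X c := alg_scalarC c x.
by rewrite /GRing.scale /= /alg_scale mulrA cx mulrA.
Qed.

End AlgebraModule.

Definition alg_morphism (k : fieldType) (X Y : algebra k) (f : X -> Y) : Prop :=
  linear f /\ monoid_morphism f.

(* e is the structure map of a B-algebra X. *)
Definition central_morphism (k : fieldType) (B X : algebra k) (e : B -> X) :=
  alg_morphism e /\ forall b x, e b * x = x * e b.

(* Linearity in the algebra argument says that k acts on M in the same way
   through both actions. *)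
Record bimodule (k : fieldType) (A : algebra k) (M : lmodType k) := Bimodule {
  lact : A -> M -> M ;
  ract : M -> A -> M ;
  lact_linearl : forall m, linear (lact^~ m) ;
  lact_linearr : forall a, linear (lact a) ;
  ract_linearl : forall a, linear (ract^~ a) ;
  ract_linearr : forall m, linear (ract m) ;
  lact1 : forall m, lact 1 m = m ;
  ract1 : forall m, ract m 1 = m ;
  lactM : forall a b m, lact (a * b) m = lact a (lact b m) ;
  ractM : forall m a b, ract m (a * b) = ract (ract m a) b ;
  lractA : forall a m b, ract (lact a m) b = lact a (ract m b)
}.

Section Actions.
Variables (k : fieldType) (A : algebra k) (M : lmodType k) (V : bimodule A M).

Lemma lactB a : {morph lact V a : m n / m - n}.
Proof.
have lin := @lact_linearr _ _ _ V a.
by move=> m n; rewrite addrC -scaleN1r lin /= scaleN1r addrC.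
Qed.

Lemma ractB a : {morph (ract V)^~ a : m n / m - n}.
Proof.
have lin := @ract_linearl _ _ _ V a.
by move=> m n; rewrite addrC -scaleN1r lin /= scaleN1r addrC.
Qed.

Lemma lact0 a : lact V a 0 = 0.
Proof. by have := lactB a 0 0; rewrite !subrr. Qed.

Lemma ract0 a : ract V 0 a = 0.
Proof. by have := ractB a 0 0; rewrite !subrr. Qed.

End Actions.

Fact central_shuffle (R : pzRingType) (p q r a b d : R) :
    (forall x, p * x = x * p) -> (forall x, r * x = x * r) ->
  q * r * (a * b * p) * d = p * q * a * (b * d * r).
Proof.
move=> pC rC; rewrite -(pC (a * b)) [RHS]mulrA -(rC (_ * (b * d))) -(rC q).
by rewrite !mulrA -(mulrA r q p) -(pC q) !mulrA.
Qed.

Section SecondaryCohomology.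
Variables (k : fieldType) (A B : algebra k) (eps : B -> A).
Variables (M : lmodType k) (V : bimodule A M).

Local Notation "a *> m" := (lact V a m) (at level 40, left associativity).
Local Notation "m <* a" := (ract V m a) (at level 40, left associativity).

(* The elements of Hom_k(A (x) A (x) B, M), as k-trilinear maps. *)
Definition trilinear (c : A -> A -> B -> M) : Prop :=
  [/\ forall b al, linear (fun a => c a b al),
      forall a al, linear (fun b => c a b al)
    & forall a b, linear (c a b)].

Definition delta1 (u : A -> M) (a b : A) (al : B) : M :=
  (a * eps al) *> u b - u (a * b * eps al) + u a <* (b * eps al).

Definition delta2 (c : A -> A -> B -> M) (a b d : A) (al be ga : B) : M :=
  (a * eps (al * be)) *> c b d ga - c (a * b * eps al) d (be * ga)
  + c a (b * d * eps ga) (al * be) - c a b al <* (d * eps (be * ga)).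

Definition is_cocycle2 : {pred A -> A -> B -> M} :=
  fun c => `[< trilinear c /\
               forall a b d al be ga, delta2 c a b d al be ga = 0 >].

Lemma is_cocycle2P c :
  reflect (trilinear c /\ forall a b d al be ga, delta2 c a b d al be ga = 0)
    (c \in is_cocycle2).
Proof. exact: asboolP. Qed.

Lemma delta2B c e a b d al be ga :
  delta2 (c - e) a b d al be ga
  = delta2 c a b d al be ga - delta2 e a b d al be ga.
Proof.
have E (x y z t x' y' z' t' : M) :
    (x - x') - (y - y') + (z - z') - (t - t') =
    (x - y + z - t) - (x' - y' + z' - t').
  rewrite !opprD [RHS]addrACA; congr (_ + _); rewrite [RHS]addrACA.
  by congr (_ + _); rewrite [RHS]addrACA.
by rewrite /delta2 -E -lactB -ractB.
Qed.

Fact is_cocycle2_zmod_closed : zmod_closed is_cocycle2.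
Proof.
split.
  apply/is_cocycle2P; split; last first.
    by move=> *; rewrite /delta2 lact0 ract0 !subr0 addr0.
  by split=> x y c u v /=; rewrite scaler0 addr0.
move=> c e /is_cocycle2P[[c1 c2 c3] cZ] /is_cocycle2P[[e1 e2 e3] eZ].
apply/is_cocycle2P; split; last by move=> *; rewrite delta2B cZ eZ subr0.
have E (x y z t : M) (r : k) :
    r *: x + y - (r *: z + t) = r *: (x - z) + (y - t).
  by rewrite scalerBr opprD addrACA.
split=> x y r u v; rewrite -E.
- by have := c1 x y r u v; have := e1 x y r u v => /= <- <-.
- by have := c2 x y r u v; have := e2 x y r u v => /= <- <-.
- by have := c3 x y r u v; have := e3 x y r u v => /= <- <-.
Qed.

Lemma delta1_cocycle (u : {linear A -> M}) : central_morphism eps ->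
    (forall al m, eps al *> m = m <* eps al) -> delta1 u \in is_cocycle2.
Proof.
case=> [[epslin [_ epsM]] epsC] Vsym.
have ll := @lact_linearl _ _ _ V; have lr := @lact_linearr _ _ _ V.
have rl := @ract_linearl _ _ _ V; have rr := @ract_linearr _ _ _ V.
have E (r : k) (x y z x' y' z' : M) :
    (r *: x + x') - (r *: y + y') + (r *: z + z')
    = r *: (x - y + z) + (x' - y' + z').
  by rewrite scalerDr scalerBr opprD [RHS]addrACA; congr (_ + _); rewrite addrACA.
apply/is_cocycle2P; split.
  split=> x y r z t; rewrite /delta1 -E.
  - by rewrite !(mulrDl, mulrDr) -!(alg_scaleAr, alg_scaleAl) !linearP ll rl.
  - by rewrite !(mulrDl, mulrDr) -!(alg_scaleAr, alg_scaleAl) !linearP lr rr.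
  - rewrite epslin !(mulrDl, mulrDr) -!(alg_scaleAr, alg_scaleAl) !linearP.
    by rewrite ll rr.
move=> a b d al be ga; rewrite /delta2 /delta1.
have lD x m n : x *> (m + n) = x *> m + x *> n.
  by have := lr x 1 m n; rewrite !scale1r.
have rD x m n : (m + n) <* x = m <* x + n <* x.
  by have := rl x 1 m n; rewrite !scale1r.
set p := eps al; set q := eps be; set r := eps ga.
have pC x : p * x = x * p := epsC al x.
have qC x : q * x = x * q := epsC be x.
have rC x : r * x = x * r := epsC ga x.
rewrite !epsM -/p -/q -/r !(lactB, ractB, lD, rD) -!lactM -!ractM.
have -> : a * (p * q) * (b * r) = a * b * p * (q * r).
  rewrite -!mulrA; congr (_ * _).
  by rewrite (mulrA q b) (qC b) -(mulrA b q) (mulrA p b) (pC b) -!mulrA.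
have -> : a * (b * d * r) * (p * q) = a * b * p * d * (q * r).
  rewrite -!mulrA; congr (_ * (_ * _)).
  by rewrite (mulrA p d) (pC d) -(mulrA d p) rC -!mulrA.
have -> : b * d * r * (p * q) = b * p * (d * (q * r)).
  rewrite -!mulrA; congr (_ * _).
  by rewrite (mulrA p d) (pC d) -(mulrA d p) rC -!mulrA.
have -> : a * (p * q) *> (u b <* (d * r)) = a * p *> u b <* (d * (q * r)).
  rewrite (mulrA a p q) lactM -lractA Vsym -ractM lractA.
  by rewrite (mulrA q d r) (qC d) -mulrA.
set x1 := _ *> u d; set x2 := _ *> u (b * d * r); set x3 := _ *> u b <* _.
set x4 := u (_ * (q * r)); set x5 := u _ <* _; set x6 := u a <* _.
have -> : x1 - x2 + x3 - (x1 - x4 + x5) = (x3 - x5) + (x4 - x2).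
  by rewrite opprD addrACA opprB (addrC _ (x4 - x1)) subrKA addrC.
by rewrite addrA -(addrA (x3 - x5)) subrKA subrr addr0 subrr.
Qed.

HB.instance Definition _ :=
  GRing.isZmodClosed.Build _ is_cocycle2 is_cocycle2_zmod_closed.

Record cocycle2 := Cocycle2 {
  cocycle2_fun :> A -> A -> B -> M ;
  _ : cocycle2_fun \in is_cocycle2
}.

HB.instance Definition _ := [isSub for cocycle2_fun].
HB.instance Definition _ := [Choice of cocycle2 by <:].
HB.instance Definition _ := [SubChoice_isSubZmodule of cocycle2 by <:].

(* When eps is central and acts symmetrically on M, delta1_cocycle makes this
   the whole image of delta1. *)
Definition is_coboundary2 : {pred cocycle2} :=
  fun c => `[< exists u : {linear A -> M}, val c = delta1 u >].

Fact is_coboundary2_zmod_closed : zmod_closed is_coboundary2.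
Proof.
split.
  apply/asboolP; exists \0; apply/funext => a; apply/funext => b.
  by apply/funext => al; rewrite /delta1 /= lact0 ract0 subr0 addr0.
move=> c e /asboolP[u cu] /asboolP[v ev]; apply/asboolP.
exists (u \- v); rewrite raddfB /= cu ev.
apply/funext => a; apply/funext => b; apply/funext => al.
have E (x y z x' y' z' : M) :
    (x - y + z) - (x' - y' + z') = (x - x') - (y - y') + (z - z').
  by rewrite !opprD [LHS]addrACA; congr (_ + _); rewrite addrACA.
by rewrite /delta1 /= lactB ractB -E.
Qed.

HB.instance Definition _ :=
  GRing.isZmodClosed.Build _ is_coboundary2 is_coboundary2_zmod_closed.

Definition H2 : zmodType := Quotient.quot is_coboundary2.

Definition coh_class (c : cocycle2) : H2 := \pi_(Quotient.quot is_coboundary2) c.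

End SecondaryCohomology.

Section Extensions.
Variables (k : fieldType) (A B : algebra k) (eps : B -> A).
Variables (M : lmodType k) (V : bimodule A M).

Record extension := Extension {
  ext_alg : algebra k ;
  ext_eps : B -> ext_alg ;
  ext_pi : ext_alg -> A ;
  ext_in : {linear M -> ext_alg} ;
  ext_eps_central : central_morphism ext_eps ;
  ext_pi_morphism : alg_morphism ext_pi ;
  ext_pi_surj : forall a, exists x, ext_pi x = a ;
  ext_pi_eps : forall b, ext_pi (ext_eps b) = eps b ;
  ext_in_inj : injective ext_in ;
  ext_in_ker : forall x, ext_pi x = 0 <-> exists m, ext_in m = x ;
  ext_ker_sq : forall x y, ext_pi x = 0 -> ext_pi y = 0 -> x * y = 0 ;
  ext_lact : forall s : {linear A -> ext_alg}, cancel s ext_pi ->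
    forall a m, ext_in (lact V a m) = s a * ext_in m ;
  ext_ract : forall s : {linear A -> ext_alg}, cancel s ext_pi ->
    forall m a, ext_in (ract V m a) = ext_in m * s a
}.

End Extensions.

Arguments ext_eps {k A B eps M V} e b : rename.
Arguments ext_pi {k A B eps M V} e x : rename.
Arguments ext_in {k A B eps M V} e : rename.

Section ExtensionClasses.
Variables (k : fieldType) (A B : algebra k) (eps : B -> A).
Variables (M : lmodType k) (V : bimodule A M).
Local Notation extension := (extension eps V).

(* Bijectivity of F makes it an isomorphism of B-algebras; the last condition
   says that F is the identity on M, identified with both kernels. *)
Definition ext_equiv (X Y : extension) : Prop :=
  exists F : ext_alg X -> ext_alg Y,
    [/\ alg_morphism F /\ bijective F,
        forall b, F (ext_eps X b) = ext_eps Y b,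
        forall x, ext_pi Y (F x) = ext_pi X x
      & forall m, F (ext_in X m) = ext_in Y m].

(* Equivalence classes are represented as the predicates ext_equiv X. *)
Definition extension_class : Type :=
  {P : extension -> Prop | exists X, P = ext_equiv X}.

Definition ext_class (X : extension) : extension_class :=
  exist _ (ext_equiv X) (ex_intro _ X erefl).

Lemma ext_equiv_refl X : ext_equiv X X.
Proof. by exists id; split=> //; split; [split | exists id]. Qed.

Lemma ext_equiv_sym X Y : ext_equiv X Y -> ext_equiv Y X.
Proof.
case=> F [[[Flin [F1 FM]] [G FK GK]] Feps Fpi Fin].
exists G; split=> [|b|y|m].
- split; last by exists F.
  split; first by move=> c y z; apply: (can_inj FK); rewrite Flin !GK.
  split; first by apply: (can_inj FK); rewrite GK F1.
  by move=> y z; apply: (can_inj FK); rewrite FM !GK.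
- by rewrite -Feps FK.
- by rewrite -{2}(GK y) Fpi.
- by rewrite -Fin FK.
Qed.

Lemma ext_equiv_trans X Y Z : ext_equiv X Y -> ext_equiv Y Z -> ext_equiv X Z.
Proof.
case=> F [[[Flin [F1 FM]] Fbij] Feps Fpi Fin].
case=> G [[[Glin [G1 GM]] Gbij] Geps Gpi Gin].
exists (G \o F); split=> [|b|x|m] /=; rewrite ?Feps ?Gpi ?Fin //.
split; last exact: bij_comp.
split; first by move=> c x y /=; rewrite Flin Glin.
by split=> [|x y] /=; rewrite ?F1 ?FM.
Qed.

Lemma ext_classP X Y : ext_class X = ext_class Y <-> ext_equiv X Y.
Proof.
split=> [/(congr1 sval) /= ->|XY]; first exact: ext_equiv_refl.
apply: eq_exist; apply/funext => Z; apply/propext; split.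
  exact/ext_equiv_trans/ext_equiv_sym.
exact: ext_equiv_trans.
Qed.

Section SectionCocycle.
Variables (X : extension) (s : {linear A -> ext_alg X}).

(* The element m of M with ext_in X m = x, when x lies in the kernel. *)
Definition ext_retract (x : ext_alg X) : M :=
  xget 0 [set m | ext_in X m = x]%classic.

Lemma ext_retractK x : ext_pi X x = 0 -> ext_in X (ext_retract x) = x.
Proof.
by move=> /(ext_in_ker (e:=X)) /(@xgetPex _ 0 [set m | ext_in X m = x]%classic).
Qed.

Definition section_cochain (a b : A) (al : B) : M :=
  ext_retract (ext_eps X al * s a * s b - s (eps al * a * b)).

Hypothesis sK : cancel s (ext_pi X).

Lemma ext_piB x y : ext_pi X (x - y) = ext_pi X x - ext_pi X y.
Proof.
have [plin _] := ext_pi_morphism X.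
by rewrite addrC -scaleN1r plin /= scaleN1r addrC.
Qed.

Lemma ext_lact_pi x m : ext_in X (lact V (ext_pi X x) m) = x * ext_in X m.
Proof.
rewrite (ext_lact sK); apply/eqP; rewrite -subr_eq0 -mulrBl; apply/eqP.
apply: ext_ker_sq; first by rewrite ext_piB sK subrr.
by apply/ext_in_ker; exists m.
Qed.

Lemma ext_ract_pi m x : ext_in X (ract V m (ext_pi X x)) = ext_in X m * x.
Proof.
rewrite (ext_ract sK); apply/eqP; rewrite -subr_eq0 -mulrBr; apply/eqP.
apply: ext_ker_sq; last by rewrite ext_piB sK subrr.
by apply/ext_in_ker; exists m.
Qed.

Lemma section_cochainE a b al : ext_in X (section_cochain a b al)
  = ext_eps X al * s a * s b - s (eps al * a * b).
Proof.
have [_ [_ pM]] := ext_pi_morphism X.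
by apply: ext_retractK; rewrite ext_piB !pM !sK ext_pi_eps subrr.
Qed.

Hypothesis eps_central : central_morphism eps.

Fact section_cochain_trilinear : trilinear section_cochain.
Proof.
have [[epslin _] _] := eps_central.
have [[elin _] _] := ext_eps_central X.
have E (r : k) (x y z t : ext_alg X) :
    (r *: x + y) - (r *: z + t) = r *: (x - z) + (y - t).
  by rewrite scalerBr opprD addrACA.
split=> a b r x y; apply: (ext_in_inj (e := X)).
- rewrite linearP !section_cochainE -E linearP.
  by rewrite !(mulrDl, mulrDr) -!(alg_scaleAr, alg_scaleAl) linearP.
- rewrite linearP !section_cochainE -E linearP.
  by rewrite !(mulrDl, mulrDr) -!(alg_scaleAr, alg_scaleAl) linearP.
- rewrite linearP !section_cochainE -E epslin elin.
  by rewrite !(mulrDl, mulrDr) -!(alg_scaleAr, alg_scaleAl) linearP.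
Qed.

Fact section_cochain_cocycle : section_cochain \in is_cocycle2 eps V.
Proof.
apply/is_cocycle2P; split; first exact: section_cochain_trilinear.
have [[_ [_ epsM]] epsC] := eps_central.
have [[_ [_ eM]] eC] := ext_eps_central X.
have [_ [_ pM]] := ext_pi_morphism X.
move=> a b d al be ga; apply: (ext_in_inj (e := X)).
rewrite /delta2 raddf0 raddfB raddfD raddfB /=.
have -> : a * eps (al * be) = ext_pi X (ext_eps X (al * be) * s a).
  by rewrite pM sK ext_pi_eps epsC.
have -> : d * eps (be * ga) = ext_pi X (s d * ext_eps X (be * ga)).
  by rewrite pM sK ext_pi_eps.
rewrite ext_lact_pi ext_ract_pi !section_cochainE !mulrBr !mulrBl.
rewrite (_ : eps al * a * b = a * b * eps al); last by rewrite -mulrA epsC.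
rewrite (_ : eps ga * b * d = b * d * eps ga); last by rewrite -mulrA epsC.
rewrite (_ : eps (be * ga) * (a * b * eps al) * d
           = eps (al * be) * a * (b * d * eps ga)); last first.
  by rewrite !epsM; apply: central_shuffle.
set t := s (eps (al * be) * a * (b * d * eps ga)).
rewrite (_ : ext_eps X al * s a * s b * (s d * ext_eps X (be * ga))
           = ext_eps X (al * be) * s a * (ext_eps X ga * s b * s d)); last first.
  rewrite !eM; have H : s a * s b * (ext_eps X be * ext_eps X ga)
      = ext_eps X be * (s a * (ext_eps X ga * s b)).
    by rewrite [LHS]mulrA -(eC be) -!mulrA -(eC ga).
  by rewrite -eM -eC eM [LHS]mulrA -(mulrA _ (s a)) -(mulrA _ (s a * s b)) H !mulrA.
rewrite (_ : ext_eps X (be * ga) * s (a * b * eps al) * s d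
           = s (a * b * eps al) * (s d * ext_eps X (be * ga))); last first.
  by rewrite -mulrA eC mulrA.
by rewrite (addrAC _ _ (_ - t)) subrKA opprB subrKA subrr.
Qed.

Definition section_cocycle : cocycle2 eps V := Cocycle2 section_cochain_cocycle.

End SectionCocycle.

End ExtensionClasses.

(* Main.v *)
(* A linear section s turns an extension X into the vector space A x M, with
   product (a, m)(b, n) = (ab, c(a, b, 1) + an + mb) where c = c_s; as s 1 is
   a unit of X, the structure map is recovered from
   e(al) (s 1)^2 = s(eps al) + c(1, 1, al).  Hence c determines X up to
   equivalence, and conversely every 2-cocycle defines an extension by these
   formulas.  Replacing s by s + u, with u : A -> M linear, adds delta1 u
   to c. *)

Require Import Defs.
From HB Require Import structures.
From mathcomp Require Import all_boot all_algebra.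
From mathcomp Require Import boolp classical_sets functions ring_quotient.

Set Implicit Arguments.
Unset Strict Implicit.
Unset Printing Implicit Defensive.

Import GRing.Theory.
Local Open Scope ring_scope.

(** * Linear sections of surjective linear maps *)

(* Zorn's lemma yields a maximal subspace S on which f is injective, and f then
   maps S onto W. *)
Lemma linear_section (k : fieldType) (U W : lmodType k) (f : {linear U -> W}) :
  (forall y, exists x, f x = y) -> exists s : {linear W -> U}, cancel s f.
Proof.
move=> f_surj.
(* The empty set is allowed, as Zorn_bigcup requires for the empty chain. *)
pose P (S : set U) := (forall c x y, S x -> S y -> S (c *: x + y)) /\
                      (forall x, S x -> f x = 0 -> x = 0).
have [F FP Ftot|S [[Slin Sinj] Smax]] := @Zorn_bigcup U P.
  split=> [c x y [X FX Xx] [Y FY Yy]|x [X FX Xx]]; last exact: (FP X FX).2.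
  case: (Ftot X Y FX FY) => XY.
    by exists Y => //; apply: (FP Y FY).1 => //; apply: XY.
  by exists X => //; apply: (FP X FX).1 => //; apply: XY.
(* Were 0 missing, closure under combinations would force S to be empty, and the set containing only
   0 would strictly enlarge it. *)
have S0 : S 0.
  apply: contrapT => nS0; have Se x : ~ S x.
    by move=> Sx; apply: nS0; have := Slin (-1) x x Sx Sx;
      rewrite scaleN1r addNr.
  apply: (Smax [set 0]%classic).
    by split=> [x /Se //|/(_ 0 erefl)].
  by split=> [c x y -> ->|x ->] //=; rewrite scaler0 addr0.
have Sf y : exists x, S x /\ f x = y.
  have [x <-] := f_surj y; apply: contrapT => nSx.
  (* T is the span of x and S. If f x lies outside f(S), then f kills no nonzero element of T: from
     f(c x + w) = 0 with c nonzero, f x would be the image of - c^-1 w, which lies in S. *)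
  pose T := [set z : U | exists c w, S w /\ z = c *: x + w]%classic.
  apply: (Smax T).
    split=> [w Sw|TS]; first by exists 0, w; rewrite scale0r add0r.
    by apply: nSx; exists x; split=> //; apply: TS; exists 1, 0;
      rewrite scale1r addr0.
  split=> [c _ _ [d [w [Sw ->]]] [e [v [Sv ->]]]|_ [c [w [Sw ->]]]].
    exists (c * d + e), (c *: w + v); split; first exact: Slin.
    by rewrite scalerDr scalerA scalerDl addrACA.
  have [-> /=|c0] := eqVneq c 0; first by rewrite scale0r add0r; apply: Sinj.
  rewrite linearP => /eqP; rewrite addr_eq0 => /eqP fx; case: nSx.
  exists ((- c^-1) *: w + 0); split; first exact: Slin.
  by rewrite addr0 linearZ /= scaleNr -scalerN -fx scalerA mulVf // scale1r.
have [s sP] := choice Sf.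
have slin : linear s.
  (* The difference of the two sides lies in S and is killed by f. *)
  move=> c x y; apply/eqP; rewrite -subr_eq0; apply/eqP; apply: Sinj.
    rewrite (addrC (s _)) -scaleN1r.
    exact: Slin (Slin _ _ _ (sP x).1 (sP y).1) (sP _).1.
  by rewrite linearB linearP !(sP _).2 subrr.
pose sL := GRing.isLinear.Build k W U *:%R s slin.
pose sl : {linear W -> U} := HB.pack s sL.
by exists sl => y; exact: (sP y).2.
Qed.

(** * Additivity of the two actions *)

Section ActionMorphisms.
Variables (k : fieldType) (A : algebra k) (M : lmodType k) (V : bimodule A M).

Lemma lactD a : {morph lact V a : m n / m + n}.
Proof. by move=> m n; have := lact_linearr V a 1 m n; rewrite !scale1r. Qed.

Lemma ractD a : {morph (ract V)^~ a : m n / m + n}.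
Proof. by move=> m n; have := ract_linearl V a 1 m n; rewrite !scale1r. Qed.

Lemma lactN a : {morph lact V a : m / - m}.
Proof. by move=> m; rewrite -[- m]sub0r lactB lact0 sub0r. Qed.

Lemma ractN a : {morph (ract V)^~ a : m / - m}.
Proof. by move=> m; rewrite -[- m]sub0r ractB ract0 sub0r. Qed.

End ActionMorphisms.

(** * Extensions in the coordinates given by a section *)

Section Transport.
Variables (k : fieldType) (A B : algebra k) (eps : B -> A).
Variables (M : lmodType k) (V : bimodule A M).
Implicit Types X Y : extension eps V.

Lemma ext_pi_linear X : linear (ext_pi X).
Proof. by have [] := ext_pi_morphism X. Qed.

Lemma ext_piM X : {morph ext_pi X : x y / x * y}.
Proof. by have [_ []] := ext_pi_morphism X. Qed.

Lemma ext_pi1 X : ext_pi X 1 = 1.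
Proof. by have [_ []] := ext_pi_morphism X. Qed.

Lemma ext_piD X : {morph ext_pi X : x y / x + y}.
Proof. by move=> x y; have := ext_pi_linear 1 x y; rewrite !scale1r. Qed.

Lemma ext_pi_in X m : ext_pi X (ext_in X m) = 0.
Proof. by apply/ext_in_ker; exists m. Qed.

Lemma ext_inM0 X m n : ext_in X m * ext_in X n = 0.
Proof. exact: ext_ker_sq (ext_pi_in _ _) (ext_pi_in _ _). Qed.

Lemma ext_eps1 X : ext_eps X 1 = 1.
Proof. by have [[_ []]] := ext_eps_central X. Qed.

(** The M-component of x when X is split as s(A) plus the kernel. *)
Definition ext_coord X (s : A -> ext_alg X) (x : ext_alg X) : M :=
  ext_retract (x - s (ext_pi X x)).

Lemma ext_coordK X (s : A -> ext_alg X) : cancel s (ext_pi X) -> forall x,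
  ext_in X (ext_coord s x) = x - s (ext_pi X x).
Proof. by move=> sK x; rewrite ext_retractK // ext_piB sK subrr. Qed.

Lemma ext_decomp X (s : A -> ext_alg X) : cancel s (ext_pi X) -> forall x,
  x = s (ext_pi X x) + ext_in X (ext_coord s x).
Proof. by move=> sK x; rewrite ext_coordK // addrC subrK. Qed.

Lemma ext_coord_add X (s : A -> ext_alg X) : cancel s (ext_pi X) ->
  forall a m, ext_coord s (s a + ext_in X m) = m.
Proof.
move=> sK a m; apply: (ext_in_inj (e := X)).
by rewrite ext_coordK // ext_piD sK ext_pi_in addr0 addrAC subrr add0r.
Qed.

Lemma ext_coord_linear X (s : {linear A -> ext_alg X}) :
  cancel s (ext_pi X) -> linear (ext_coord s).
Proof.
move=> sK c x y; apply: (ext_in_inj (e := X)).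
rewrite linearP !ext_coordK // ext_pi_linear linearP scalerBr.
by rewrite opprD addrACA.
Qed.

Lemma section_mul X (s : {linear A -> ext_alg X})
    (sK : cancel s (ext_pi X)) a b :
  s a * s b = s (a * b) + ext_in X (section_cochain s a b 1).
Proof.
rewrite section_cochainE // ext_eps1 mul1r -(ext_pi_eps X) ext_eps1 ext_pi1.
by rewrite mul1r [RHS]addrC subrK.
Qed.

(** Products of kernel elements vanish and the mixed terms are the two actions, so the values c_s(a,
    b, 1) and the bimodule fix the whole product. *)
Lemma ext_mulE X (s : {linear A -> ext_alg X})
    (sK : cancel s (ext_pi X)) a b m n :
  (s a + ext_in X m) * (s b + ext_in X n) =
  s (a * b) + ext_in X (section_cochain s a b 1 + (lact V a n + ract V m b)).
Proof.
rewrite mulrDl !mulrDr ext_inM0 addr0 section_mul //.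
by rewrite -(ext_lact sK) -(ext_ract sK) !raddfD /= -!addrA.
Qed.

(* Modulo the square-zero kernel, s 1 is 1. *)
Lemma section1_rinv X (s : A -> ext_alg X) : cancel s (ext_pi X) ->
  s 1 * (1 + 1 - s 1) = 1.
Proof.
move=> sK; pose z : ext_alg X := s 1 - 1.
have z2 : z * z = 0.
  by apply: (ext_ker_sq (e := X)); rewrite ext_piB sK ext_pi1 subrr.
have -> : s 1 = z + 1 by rewrite subrK.
rewrite mulrDl mul1r opprD addrACA subrr addr0 mulrBr mulr1 z2 subr0.
by rewrite [LHS]addrC subrK.
Qed.

(** The map s a + m |-> t a + m, which matches the coordinates of X and Y. *)
Definition ext_transport X Y (s : A -> ext_alg X) (t : A -> ext_alg Y) x :=
  t (ext_pi X x) + ext_in Y (ext_coord s x).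

Lemma ext_transportK X Y (s : A -> ext_alg X) (t : A -> ext_alg Y) :
  cancel s (ext_pi X) -> cancel t (ext_pi Y) ->
  cancel (ext_transport s t) (ext_transport t s).
Proof.
move=> sK tK x; rewrite {1}/ext_transport /ext_transport ext_coord_add //.
by rewrite ext_piD tK ext_pi_in addr0 -ext_decomp.
Qed.

(** The coordinate map is multiplicative by [ext_mulE], as the values at (a, b, 1) agree. The values
    at (1, 1, b) then give the compatibility with the structure maps. *)
Lemma ext_equiv_section_cochain X Y
    (s : {linear A -> ext_alg X}) (sK : cancel s (ext_pi X))
    (t : {linear A -> ext_alg Y}) (tK : cancel t (ext_pi Y)) :
  section_cochain s = section_cochain t -> ext_equiv X Y.
Proof.
move=> st; pose F := ext_transport s t.
have FE a m : F (s a + ext_in X m) = t a + ext_in Y m.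
  by rewrite /F /ext_transport ext_piD sK ext_pi_in addr0 ext_coord_add.
have Fpi x : ext_pi Y (F x) = ext_pi X x by rewrite ext_piD tK ext_pi_in addr0.
have Fin m : F (ext_in X m) = ext_in Y m.
  by have := FE 0 m; rewrite !raddf0 !add0r.
have Fs a : F (s a) = t a by have := FE a 0; rewrite !raddf0 !addr0.
have FM x y : F (x * y) = F x * F y.
  rewrite (ext_decomp sK x) (ext_decomp sK y) ext_mulE // !FE ext_mulE //.
  by rewrite st.
have Feps b : F (ext_eps X b) = ext_eps Y b.
  (* The cochain controls only the product of the structure map with (s 1)^2, so the unit t 1 is
     cancelled twice on the right. *)
  have t1K : cancel (fun y => y * t 1) (fun y => y * (1 + 1 - t 1)).
    by move=> y; rewrite -mulrA section1_rinv // mulr1.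
  apply: (can_inj t1K); apply: (can_inj t1K); rewrite /= -Fs -!FM Fs.
  rewrite -(subrK (s (eps b * 1 * 1)) (_ * _ * s 1)) -section_cochainE //.
  rewrite addrC FE st section_cochainE //.
  by rewrite addrC subrK.
exists F; split=> //; split.
  split; first by move=> c x y; rewrite /F /ext_transport ext_pi_linear
    ext_coord_linear // !linearP scalerDr addrACA.
  (* As s 1 need not be 1, F 1 = 1 is read off the structure maps. *)
  by split=> //; rewrite -(ext_eps1 X) Feps ext_eps1.
exists (ext_transport t s); exact: ext_transportK.
Qed.

(** Lets a section be pushed along an equivalence without changing its cochain, so that only
    sections of one extension remain to be compared. *)
Lemma section_cochain_morphism X Y (F : ext_alg X -> ext_alg Y)
    (s : {linear A -> ext_alg X}) (sK : cancel s (ext_pi X))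
    (t : {linear A -> ext_alg Y}) (tK : cancel t (ext_pi Y)) :
  alg_morphism F -> (forall b, F (ext_eps X b) = ext_eps Y b) ->
  (forall m, F (ext_in X m) = ext_in Y m) ->
  (forall a, t a = F (s a)) -> section_cochain t = section_cochain s.
Proof.
move=> [Flin [_ FM]] Feps Fin tE.
apply/funext => a; apply/funext => b; apply/funext => al.
apply: (ext_in_inj (e := Y)); rewrite section_cochainE // !tE -Feps -!FM -Fin.
rewrite section_cochainE // -scaleN1r -[in RHS]scaleN1r addrC [in RHS]addrC.
by rewrite Flin.
Qed.

Hypothesis eps_central : central_morphism eps.

(** The actions may be computed with any lifts. Lifting a through t and b through s makes the two
    cross terms, both the image of al times t(a) s(b), cancel. *)
Lemma section_cochain_sub X
    (s : {linear A -> ext_alg X}) (sK : cancel s (ext_pi X))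
    (t : {linear A -> ext_alg X}) (tK : cancel t (ext_pi X))
    (u : A -> M) a b al :
  (forall a, ext_in X (u a) = s a - t a) ->
  section_cochain s a b al - section_cochain t a b al = delta1 eps V u a b al.
Proof.
move=> uE.
have eC be (x : ext_alg X) : ext_eps X be * x = x * ext_eps X be.
  by have [_] := ext_eps_central X.
have [_ epsC] := eps_central.
apply: (ext_in_inj (e := X)); rewrite /delta1 raddfB /= !section_cochainE //.
rewrite (raddfD (ext_in X)) (raddfB (ext_in X)) /=.
have -> : a * eps al = ext_pi X (ext_eps X al * t a).
  by rewrite ext_piM tK ext_pi_eps epsC.
have -> : b * eps al = ext_pi X (ext_eps X al * s b).
  by rewrite ext_piM sK ext_pi_eps epsC.
rewrite (ext_lact_pi tK) (ext_ract_pi tK) -mulrA -epsC !uE mulrBr mulrBl.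
rewrite !mulrA -(eC al (s a)) -(eC al (t a)).
set p := _ * s a * s b; set q := _ * t a * t b; set r := _ * t a * s b.
by rewrite opprD addrACA -opprD [RHS]addrC [RHS]addrA subrKA.
Qed.

End Transport.

(** * The extension defined by a 2-cocycle *)

Section TwistedExtension.
Variables (k : fieldType) (A B : algebra k) (eps : B -> A).
Variables (M : lmodType k) (V : bimodule A M).
Hypothesis eps_central : central_morphism eps.
Hypothesis V_sym : forall al m, lact V (eps al) m = ract V m (eps al).
Variable c : cocycle2 eps V.

Local Notation "a *> m" := (lact V a m) (at level 40, left associativity).
Local Notation "m <* a" := (ract V m a) (at level 40, left associativity).

Let eps1 : eps 1 = 1. Proof. by have [[_ []]] := eps_central. Qed.
Let epsM : {morph eps : x y / x * y}.
Proof. by have [[_ []]] := eps_central. Qed.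
Let epsC b x : eps b * x = x * eps b. Proof. by have [_] := eps_central. Qed.
Let epsP : linear eps. Proof. by have [[]] := eps_central. Qed.

Lemma cocycle2_trilinear : trilinear c.
Proof. by have /is_cocycle2P[] := valP c. Qed.

Lemma cocycle2_linearl b al : linear (fun a => c a b al).
Proof. by have [] := cocycle2_trilinear. Qed.

Lemma cocycle2_linearm a al : linear (fun b => c a b al).
Proof. by have [] := cocycle2_trilinear. Qed.

Lemma cocycle2_linearr a b : linear (c a b).
Proof. by have [] := cocycle2_trilinear. Qed.

(** The identities below all arise from this one by setting some arguments to 1. *)
Lemma cocycle2E a b d al be ga :
  a * eps (al * be) *> c b d ga + c a (b * d * eps ga) (al * be) =
  c (a * b * eps al) d (be * ga) + c a b al <* (d * eps (be * ga)).
Proof.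
have /is_cocycle2P[_ /(_ a b d al be ga)] := valP c; rewrite /delta2.
by move/eqP; rewrite subr_eq0 addrAC subr_eq => /eqP ->; rewrite addrC.
Qed.

Lemma cocycle2_assoc a b d :
  a *> c b d 1 + c a (b * d) 1 = c (a * b) d 1 + c a b 1 <* d.
Proof. by have := cocycle2E a b d 1 1 1; rewrite !mulr1 eps1 !mulr1. Qed.

(** In the associativity identity at (1, 1, d), the term c 1 d 1 occurs twice on the left and once
    on the right. The cocycle is not assumed normalized; this lemma and its mirror image reduce its
    values at the unit to c 1 1 1. *)
Lemma cocycle2_1l d : c 1 d 1 = c 1 1 1 <* d.
Proof.
by have := cocycle2_assoc 1 1 d; rewrite lact1 !mul1r => /addrI.
Qed.

Lemma cocycle2_1r a : c a 1 1 = a *> c 1 1 1.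
Proof.
by have := cocycle2_assoc a 1 1; rewrite ract1 !mulr1 [RHS]addrC => /addIr ->.
Qed.

Lemma cocycle2_eps_swap b be :
  eps be *> c b 1 1 + c 1 b be = c b 1 be + c 1 b 1 <* eps be.
Proof.
by have := cocycle2E 1 b 1 1 be 1; rewrite !(mul1r, mulr1) eps1 !mulr1.
Qed.

Lemma cocycle2_epsl al d b :
  eps al *> c b d 1 + c 1 (b * d) al = c (b * eps al) d 1 + c 1 b al <* d.
Proof.
by have := cocycle2E 1 b d al 1 1; rewrite !(mul1r, mulr1) eps1 !mulr1.
Qed.

Lemma cocycle2_epsm be b d :
  eps be *> c b d 1 + c 1 (b * d) be = c b d be + c 1 b 1 <* (d * eps be).
Proof.
by have := cocycle2E 1 b d 1 be 1; rewrite !(mul1r, mulr1) eps1 !mulr1.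
Qed.

Lemma cocycle2_epsr a ga :
  a *> c 1 1 ga + c a (eps ga) 1 = c a 1 ga + c a 1 1 <* eps ga.
Proof.
by have := cocycle2E a 1 1 1 1 ga; rewrite !(mul1r, mulr1) eps1 !mulr1.
Qed.

Lemma cocycle2_epsM al be :
  eps al *> c 1 1 be + c 1 (eps be) al =
  c 1 1 (al * be) + c 1 1 1 <* eps (al * be).
Proof.
by have := cocycle2E 1 1 1 1 al be; rewrite !(mul1r, mulr1) eps1.
Qed.

Definition twisted_mul (x y : A * M) : A * M :=
  (x.1 * y.1, c x.1 y.1 1 + (x.1 *> y.2 + x.2 <* y.1)).

(** By [cocycle2_1l], a left unit (1, m) must satisfy (c 1 1 1 + m) a = 0 for all a, which at a = 1
    forces this second component. *)
Definition twisted_one : A * M := (1, - c 1 1 1).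

Fact twisted_mulA : associative twisted_mul.
Proof.
move=> [a m] [b n] [d p]; congr pair => /=; first exact: mulrA.
rewrite !lactD !ractD -lactM -ractM lractA.
rewrite -[in LHS](addrA (a *> c b d 1)) [LHS]addrA [X in X + _ = _]addrC.
rewrite cocycle2_assoc (addrCA (_ *> p)) [RHS]addrA.
by congr (_ + _); rewrite -addrA.
Qed.

Fact twisted_mul1x : left_id twisted_one twisted_mul.
Proof.
move=> [a m]; congr pair => /=; first exact: mul1r.
by rewrite lact1 ractN cocycle2_1l addrCA subrr addr0.
Qed.

Fact twisted_mulx1 : right_id twisted_one twisted_mul.
Proof.
move=> [a m]; congr pair => /=; first exact: mulr1.
by rewrite ract1 lactN cocycle2_1r addrA subrr add0r.
Qed.

Fact twisted_mulPl y : linear (twisted_mul^~ y).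
Proof.
case: y => b n r [a m] [a' m']; congr pair => /=.
  by rewrite mulrDl alg_scaleAl.
rewrite cocycle2_linearl lact_linearl ract_linearl /=.
by rewrite !scalerDr [RHS]addrACA; congr (_ + _); rewrite addrACA.
Qed.

Fact twisted_mulPr x : linear (twisted_mul x).
Proof.
case: x => b n r [a m] [a' m']; congr pair => /=.
  by rewrite mulrDr alg_scaleAr.
rewrite cocycle2_linearm lact_linearr ract_linearr /=.
by rewrite !scalerDr [RHS]addrACA; congr (_ + _); rewrite addrACA.
Qed.

Fact twisted_mulDl : left_distributive twisted_mul +%R.
Proof.
by move=> x y z; have := twisted_mulPl z 1 x y; rewrite !scale1r.
Qed.

Fact twisted_mulDr : right_distributive twisted_mul +%R.
Proof.
by move=> x y z; have := twisted_mulPr x 1 y z; rewrite !scale1r.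
Qed.

Definition twisted_ring : pzRingType :=
  HB.pack (A * M)%type (GRing.Zmodule_isPzRing.Build (A * M)%type
    twisted_mulA twisted_mul1x twisted_mulx1 twisted_mulDl twisted_mulDr).

Fact twisted_scaleAl r x y : r *: twisted_mul x y = twisted_mul (r *: x) y.
Proof.
have tw0 : twisted_mul 0 y = 0 := mul0r (y : twisted_ring).
by have := twisted_mulPl y r x 0; rewrite !addr0 tw0 addr0.
Qed.

Fact twisted_scaleAr r x y : r *: twisted_mul x y = twisted_mul x (r *: y).
Proof.
have tw0 : twisted_mul x 0 = 0 := mulr0 (x : twisted_ring).
by have := twisted_mulPr x r y 0; rewrite !addr0 tw0 addr0.
Qed.

Definition twisted_scalar (r : k) : twisted_ring := r *: twisted_one.

Fact twisted_scalarE r x : twisted_mul (twisted_scalar r) x = r *: x.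
Proof. by rewrite -twisted_scaleAl twisted_mul1x. Qed.

Fact twisted_scalar_zmod : zmod_morphism twisted_scalar.
Proof. by move=> r r'; rewrite /twisted_scalar scalerBl. Qed.

Fact twisted_scalar_monoid : monoid_morphism twisted_scalar.
Proof.
split=> [|r r']; first exact: scale1r.
by rewrite [RHS]twisted_scalarE /twisted_scalar scalerA.
Qed.

HB.instance Definition _ :=
  GRing.isZmodMorphism.Build k twisted_ring twisted_scalar twisted_scalar_zmod.
HB.instance Definition _ :=
  GRing.isMonoidMorphism.Build k twisted_ring twisted_scalar
    twisted_scalar_monoid.

Fact twisted_scalarC r (x : twisted_ring) :
  twisted_scalar r * x = x * twisted_scalar r.
Proof.
rewrite [LHS]twisted_scalarE.
change (r *: (x : A * M) = twisted_mul x (r *: twisted_one)).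
by rewrite -twisted_scaleAr twisted_mulx1.
Qed.

Definition twisted_algebra : algebra k :=
  @Algebra k twisted_ring twisted_scalar twisted_scalarC.

(** For s 1 = (1, 0) = 1 + z with z = (0, c 1 1 1) of square zero, (s 1)^-2 = 1 - 2z. Multiplying
    (eps al, c 1 1 al) by it on the right gives this formula, with the correction subtracted
    twice. *)
Definition twisted_eps (al : B) : twisted_algebra :=
  (eps al, c 1 1 al - eps al *> c 1 1 1 - eps al *> c 1 1 1).

Definition twisted_pi (x : twisted_algebra) : A := x.1.

Definition twisted_in (m : M) : twisted_algebra := (0, m).

Definition twisted_section (a : A) : twisted_algebra := (a, 0).

(** The scaling on the left comes from [twisted_scalar], the one on the right is componentwise on
    the product; linearity proofs pass from the first to the second. *)
Lemma twisted_scaleE (r : k) (x : twisted_algebra) : r *: x = r *: (x : A * M).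
Proof. exact: twisted_scalarE. Qed.

Let unit_act al : eps al *> c 1 1 1 = c 1 1 1 <* eps al.
Proof. exact: V_sym. Qed.

(** The cocycle identity trades c (eps al) b 1 for c 1 b al and absorbs one of the two corrections
    in [twisted_eps]. *)
Lemma twisted_eps_mull al (b : A) (n : M) :
  twisted_eps al * ((b, n) : twisted_algebra) =
  (eps al * b, eps al *> n + (c 1 b al - (eps al *> c 1 1 1) <* b)).
Proof.
congr pair => /=; have := cocycle2_epsl al b 1.
rewrite !mul1r cocycle2_1l -lractA => H.
rewrite addrCA !ractB; congr (_ + _); rewrite !addrA -H.
by rewrite [X in X - _]addrAC subrr add0r.
Qed.

Lemma twisted_eps_mulr al (b : A) (n : M) :
  ((b, n) : twisted_algebra) * twisted_eps al =
  (b * eps al, n <* eps al + (c b 1 al - b *> (eps al *> c 1 1 1))).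
Proof.
congr pair => /=; have := cocycle2_epsr b al.
rewrite cocycle2_1r lractA -V_sym => H.
rewrite [_ + n <* _]addrC addrCA !lactB; congr (_ + _).
by rewrite !addrA (addrC (c b _ _)) H addrK.
Qed.

Fact twisted_eps_central : central_morphism twisted_eps.
Proof.
split; last first.
  move=> al [b n]; rewrite twisted_eps_mull twisted_eps_mulr V_sym epsC.
  (* Once the two products are expanded, centrality compares c 1 b al with c b 1 al, up to multiples
     of c 1 1 1. *)
  congr (_, _ + _); have := cocycle2_eps_swap b al.
  rewrite cocycle2_1r -lactM epsC lactM (cocycle2_1l b).
  rewrite -ractM -epsC ractM -V_sym.
  by move=> H; apply/eqP; rewrite subr_eq addrAC -H addrAC subrr add0r.
split; last split.
- move=> r x y; rewrite twisted_scaleE; congr pair => /=; first exact: epsP.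
  rewrite epsP cocycle2_linearr lact_linearl /= !scalerBr !opprD.
  by rewrite [RHS]addrACA; congr (_ + _); rewrite addrACA.
- by rewrite /twisted_eps eps1 lact1 subrr sub0r.
- move=> al be; rewrite [RHS]twisted_eps_mull /twisted_eps epsM.
  have := cocycle2_epsM al be; rewrite -unit_act => H.
  congr pair; rewrite !lactB lractA -unit_act -lactM -epsM addrA.
  by rewrite ![in RHS](addrAC _ _ (c _ (eps be) _)) H addrK.
Qed.

Fact twisted_pi_morphism : alg_morphism twisted_pi.
Proof. by split=> // r x y; rewrite twisted_scaleE. Qed.

Fact twisted_in_linear : linear twisted_in.
Proof.
move=> r m n; rewrite twisted_scaleE; congr pair.
by rewrite /= scaler0 addr0.
Qed.

HB.instance Definition _ :=
  GRing.isLinear.Build k M twisted_algebra *:%R twisted_in twisted_in_linear.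

Fact twisted_section_linear : linear twisted_section.
Proof.
move=> r m n; rewrite twisted_scaleE; congr pair.
by rewrite /= scaler0 addr0.
Qed.

HB.instance Definition _ :=
  GRing.isLinear.Build k A twisted_algebra *:%R twisted_section
    twisted_section_linear.

(** Linearity at -1, 0, 0 reads f 0 = - f 0 + f 0. *)
Let c0l b al : c 0 b al = 0.
Proof.
by have := cocycle2_linearl b al (-1) 0 0; rewrite scaler0 addr0 scaleN1r addNr.
Qed.

Let c0r b al : c b 0 al = 0.
Proof.
by have := cocycle2_linearm b al (-1) 0 0; rewrite scaler0 addr0 scaleN1r addNr.
Qed.

Let l0 m : 0 *> m = 0.
Proof.
by have := lact_linearl V m (-1) 0 0; rewrite scaler0 addr0 scaleN1r addNr.
Qed.

Let r0 m : m <* 0 = 0.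
Proof.
by have := ract_linearr V m (-1) 0 0; rewrite scaler0 addr0 scaleN1r addNr.
Qed.

Fact twisted_in_inj : injective twisted_in.
Proof. by move=> m n []. Qed.

Fact twisted_in_ker x : twisted_pi x = 0 <-> exists m, twisted_in m = x.
Proof.
by split=> [|[m <-]] //; case: x => a m /= ->; exists m.
Qed.

Fact twisted_ker_sq x y : twisted_pi x = 0 -> twisted_pi y = 0 -> x * y = 0.
Proof.
case: x y => a m [b n]; rewrite /twisted_pi /= => -> ->.
by congr pair; rewrite /= ?mul0r // c0l l0 r0 !addr0.
Qed.

(** A lift of a may have any second component n, but in the product with (0, m) it only contributes
    n acted on by 0. *)
Fact twisted_lact (s : {linear A -> twisted_algebra}) : cancel s twisted_pi ->
  forall a m, twisted_in (a *> m) = s a * twisted_in m.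
Proof.
move=> sK a m; have := sK a; case: (s a) => x n; rewrite /twisted_pi /= => ->.
by congr pair; rewrite /= ?mulr0 // c0r r0 add0r addr0.
Qed.

Fact twisted_ract (s : {linear A -> twisted_algebra}) : cancel s twisted_pi ->
  forall m a, twisted_in (m <* a) = twisted_in m * s a.
Proof.
move=> sK m a; have := sK a; case: (s a) => x n; rewrite /twisted_pi /= => ->.
by congr pair; rewrite /= ?mul0r // c0l l0 !add0r.
Qed.

Definition twisted_extension : extension eps V :=
  @Extension _ _ _ eps _ V twisted_algebra twisted_eps twisted_pi twisted_in
    twisted_eps_central twisted_pi_morphism
    (fun a => ex_intro _ (twisted_section a) erefl)
    (fun=> erefl) twisted_in_inj twisted_in_ker twisted_ker_sq
    twisted_lact twisted_ract.

Lemma twisted_sectionK : cancel twisted_section (ext_pi twisted_extension).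
Proof. by []. Qed.

Lemma section_cochain_twisted :
  section_cochain (X := twisted_extension) twisted_section = c.
Proof.
apply/funext => a; apply/funext => b; apply/funext => al.
apply: (ext_in_inj (e := twisted_extension)).
rewrite section_cochainE; last exact: twisted_sectionK.
(* These two instances share their left side. Equating the right sides yields c a b al from c (a *
   eps al) b 1 and c 1 a al, the terms produced by the product in the extension. *)
have := cocycle2_epsl al b a; rewrite (cocycle2_epsm al a b) (cocycle2_1l a).
rewrite -ractM mulrA -epsC ractM -V_sym -(epsC al a) => H.
rewrite [X in X * _]twisted_eps_mull; congr pair; first by rewrite /= subrr.
rewrite /= !lact0 !add0r ractB -ractM.
by rewrite subr0 addrA -H addrK.
Qed.

End TwistedExtension.

(** * Equivalence classes and cohomology classes *)

Section Classification.
Variables (k : fieldType) (A B : algebra k) (eps : B -> A).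
Variables (M : lmodType k) (V : bimodule A M).
Hypothesis eps_central : central_morphism eps.
Implicit Types X Y : extension eps V.

Lemma ext_section X : exists s : {linear A -> ext_alg X}, cancel s (ext_pi X).
Proof.
pose piL := GRing.isLinear.Build k (ext_alg X) A *:%R (ext_pi X)
  (@ext_pi_linear _ _ _ _ _ _ X).
pose p : {linear ext_alg X -> A} := HB.pack (ext_pi X) piL.
exact: (@linear_section k _ _ p (@ext_pi_surj _ _ _ _ _ _ X)).
Qed.

Lemma coh_classP (c d : cocycle2 eps V) :
  coh_class c = coh_class d <->
  exists u : {linear A -> M},
    forall a b al, c a b al - d a b al = delta1 eps V u a b al.
Proof.
split.
  move=> /eqquotP; rewrite Quotient.equivE => /asboolP[u cdu].
  exists u => a b al.
  by move: cdu; rewrite raddfB => <-.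
move=> [u cdu]; apply/eqquotP; rewrite Quotient.equivE; apply/asboolP; exists u.
rewrite raddfB; apply/funext => a; apply/funext => b; apply/funext => al.
exact: cdu.
Qed.

(** For X = Y this is independence of the section; in general, one direction is invariance under
    equivalence and the other is injectivity. *)
Lemma ext_equiv_coh_class X Y
    (s : {linear A -> ext_alg X}) (sK : cancel s (ext_pi X))
    (t : {linear A -> ext_alg Y}) (tK : cancel t (ext_pi Y)) :
  ext_equiv X Y <-> coh_class (section_cocycle sK eps_central) =
                    coh_class (section_cocycle tK eps_central).
Proof.
split=> [[F [[[Flin F1M] _] Feps Fpi Fin]]|/coh_classP[u stu]].
- pose FL := GRing.isLinear.Build k _ _ *:%R F Flin.
  pose Fl : {linear ext_alg X -> ext_alg Y} := HB.pack F FL.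
  (* The pushed section s' has the cochain of s and lifts A to Y, so s' - t takes values in the
     kernel and gives u. *)
  pose s' : {linear A -> ext_alg Y} := Fl \o s.
  have s'K : cancel s' (ext_pi Y) by move=> a; rewrite /= Fpi sK.
  have s's : section_cochain s' = section_cochain s.
    by apply: (section_cochain_morphism sK s'K (F := F)).
  pose u (a : A) : M := ext_retract (s' a - t a).
  have uE a : ext_in Y (u a) = s' a - t a.
    by rewrite ext_retractK // ext_piB s'K tK subrr.
  have ulin : linear u.
    move=> r a b; apply: (ext_in_inj (e := Y)).
    rewrite [RHS]linearP !uE (linearP s') (linearP t).
    by rewrite scalerBr opprD addrACA.
  pose uL := GRing.isLinear.Build k _ _ *:%R u ulin.
  pose ul : {linear A -> M} := HB.pack u uL.
  apply/coh_classP; exists ul => a b al /=.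
  by rewrite -s's; apply: section_cochain_sub.
(* Shifting t by u adds the coboundary of u to its cochain, so t' has exactly the cochain of s. *)
- pose t' : {linear A -> ext_alg Y} := t \+ (ext_in Y \o u).
  have t'K : cancel t' (ext_pi Y).
    by move=> a; rewrite /= ext_piD tK ext_pi_in addr0.
  apply: (ext_equiv_section_cochain sK t'K).
  apply/funext => a; apply/funext => b; apply/funext => al.
  apply: (addIr (- section_cochain t a b al)); rewrite [LHS]stu.
  rewrite (section_cochain_sub eps_central t'K tK (u := u)) //.
  by move=> x; rewrite /= addrC addKr.
Qed.

End Classification.

Theorem mainTheorem5 (k : fieldType) (A B : algebra k)
    (B_comm : forall x y : B, x * y = y * x)
    (eps : B -> A) (eps_central : central_morphism eps)
    (M : lmodType k) (V : bimodule A M)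
    (V_sym : forall (al : B) (m : M), lact V (eps al) m = ract V m (eps al)) :
  (forall X : extension eps V,
     exists s : {linear A -> ext_alg X}, cancel s (ext_pi X)) /\
  exists Phi : extension_class eps V -> H2 eps V,
    (forall (X : extension eps V) (s : {linear A -> ext_alg X})
            (sK : cancel s (ext_pi X)),
       Phi (ext_class X) = coh_class (section_cocycle sK eps_central)) /\
    bijective Phi.
Proof.
split; first exact: ext_section.
(* Sections, and below representatives of classes, are chosen arbitrarily; [clsP] shows that the
   choices do not matter. *)
pose sec (X : extension eps V) := cid (ext_section X).
pose cls X := coh_class (section_cocycle (svalP (sec X)) eps_central).
have clsP X Y : ext_equiv X Y <-> cls X = cls Y by exact: ext_equiv_coh_class.
pose Phi (P : extension_class eps V) := cls (sval (cid (svalP P))).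
have PhiE X : Phi (ext_class X) = cls X.
  rewrite /Phi; case: (cid _) => Y /= XY; apply/clsP.
  by apply: ext_equiv_sym; rewrite XY; exact: ext_equiv_refl.
have PhiS X (s : {linear A -> ext_alg X}) (sK : cancel s (ext_pi X)) :
    Phi (ext_class X) = coh_class (section_cocycle sK eps_central).
  by rewrite PhiE; apply/ext_equiv_coh_class/ext_equiv_refl.
have ext_classE (P : extension_class eps V) : exists X, P = ext_class X.
  by case: P => P [X PX]; exists X; apply: eq_exist.
have Phi_surj h : exists X, Phi (ext_class X) = h.
  (* The extension built from a representative of h has a section whose cochain is that
     representative. *)
  exists (twisted_extension eps_central V_sym (repr h)).
  rewrite (PhiS _ _ (twisted_sectionK eps_central V_sym _)).
  rewrite -[RHS]reprK; congr (\pi _)%qT.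
  by apply: val_inj; exact: section_cochain_twisted.
have [g gK] := choice Phi_surj.
(* The inverse sends h to the class of an extension chosen over h. It is also a left inverse by the
   injectivity contained in [clsP]. *)
exists Phi; split=> //; exists (fun h => ext_class (g h)) => // P.
have [X ->] := ext_classE P; apply/ext_classP/clsP.
by rewrite -!PhiE gK.
Qed.
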